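(* Let $\mathcal{H}$ be a right quaternionic Hilbert space, $I$ a countable set and $\{u_i\}_{i\in I}\subset\mathcal{H}$ a family of vectors. Let $S:\mathcal{H}\to\mathcal{H}$, $Su=\sum_{i\in I}u_i\langle u_i,u\rangle$, be its frame operator. Then the following statements are equivalent: (1) $\{u_i\}_{i\in I}$ is a frame for $\mathcal{H}$. (2) $S$ is well defined (i.e. the series $\sum_{i\in I}u_i\langle u_i,u\rangle$ converges in $\mathcal{H}$ for every $u\in\mathcal{H}$) and surjective.
   Context: $\mathbb{H}$ is the skew field of quaternions, with conjugation $q\mapsto\overline q$ and modulus $|q|$. A right quaternionic Hilbert space is a right $\mathbb{H}$-vector space $\mathcal{H}$ with a map $\langle\cdot\mid\cdot\rangle:\mathcal{H}\times\mathcal{H}\to\mathbb{H}$ (also written $\langle\cdot,\cdot\rangle$) satisfying $\langle u\mid v\rangle=\overline{\langle v\mid u\rangle}$, $\langle v\mid v\rangle>0$ for $v\neq0$, additivity in the second variable and $\langle v\mid uq\rangle=\langle v\mid u\rangle q$ for $q\in\mathbb{H}$, which is complete for the norm $\|u\|=\sqrt{\langle u\mid u\rangle}$. A family $\{u_i\}_{i\in I}$ in $\mathcal{H}$ is a frame for $\mathcal{H}$ if there exist $0<A\le B<\infty$ with $A\|u\|^2\le\sum_{i\in I}|\langle u_i,u\rangle|^2\le B\|u\|^2$ for all $u\in\mathcal{H}$. Sums of vectors over $I$ are norm limits of the net of finite partial sums (unconditional convergence). *)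

(* Defs.v *)
From HB Require Import structures.
From mathcomp Require Import all_boot all_order all_algebra finmap ring.
From mathcomp Require Import all_classical all_reals all_analysis.
From mathcomp Require Import showcase.summability.

Set Implicit Arguments.
Unset Strict Implicit.
Unset Printing Implicit Defensive.

Import Order.TTheory GRing.Theory Num.Theory.
Import numFieldNormedType.Exports.

Local Open Scope classical_set_scope.
Local Open Scope ring_scope.

(* [Quat a b c d] is the quaternion a + b i + c j + d k. *)
Record quat (R : Type) := Quat { qre : R; qi : R; qj : R; qk : R }.

Section QuatRing.
Variable R : realType.
Implicit Types p q : quat R.

Definition quat_tuple q := (qre q, qi q, qj q, qk q).
Definition tuple_quat (x : R * R * R * R) :=
  let: (a, b, c, d) := x in Quat a b c d.

Lemma quat_tupleK : cancel quat_tuple tuple_quat.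
Proof. by case. Qed.

HB.instance Definition _ := Equality.copy (quat R) (can_type quat_tupleK).
HB.instance Definition _ := Choice.copy (quat R) (can_type quat_tupleK).

Definition quat0 : quat R := Quat 0 0 0 0.
Definition quat1 : quat R := Quat 1 0 0 0.
Definition quat_add p q :=
  Quat (qre p + qre q) (qi p + qi q) (qj p + qj q) (qk p + qk q).
Definition quat_opp q := Quat (- qre q) (- qi q) (- qj q) (- qk q).

(* Hamilton's relations: i^2 = j^2 = k^2 = ijk = -1. *)
Definition quat_mul p q :=
  Quat (qre p * qre q - qi p * qi q - qj p * qj q - qk p * qk q)
       (qre p * qi q + qi p * qre q + qj p * qk q - qk p * qj q)
       (qre p * qj q - qi p * qk q + qj p * qre q + qk p * qi q)
       (qre p * qk q + qi p * qj q - qj p * qi q + qk p * qre q).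

Lemma quat_addA : associative quat_add.
Proof. by move=> [? ? ? ?] [? ? ? ?] [? ? ? ?]; rewrite /quat_add /= !addrA. Qed.
Lemma quat_addC : commutative quat_add.
Proof. by move=> [a b c d] [? ? ? ?]; congr Quat; rewrite /= addrC. Qed.
Lemma quat_add0q : left_id quat0 quat_add.
Proof. by move=> [? ? ? ?]; rewrite /quat_add /= !add0r. Qed.
Lemma quat_addNq : left_inverse quat0 quat_opp quat_add.
Proof. by move=> [? ? ? ?]; rewrite /quat_add /= !addNr. Qed.

HB.instance Definition _ :=
  GRing.isZmodule.Build (quat R) quat_addA quat_addC quat_add0q quat_addNq.

Lemma quat_mulA : associative quat_mul.
Proof. by move=> [? ? ? ?] [? ? ? ?] [? ? ? ?]; congr Quat => /=; ring. Qed.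
Lemma quat_mul1q : left_id quat1 quat_mul.
Proof. by move=> [? ? ? ?]; rewrite /quat_mul /=; congr Quat; ring. Qed.
Lemma quat_mul1 : right_id quat1 quat_mul.
Proof. by move=> [? ? ? ?]; rewrite /quat_mul /=; congr Quat; ring. Qed.
Lemma quat_mulDl : left_distributive quat_mul quat_add.
Proof. by move=> [? ? ? ?] [? ? ? ?] [? ? ? ?]; congr Quat => /=; ring. Qed.
Lemma quat_mulDr : right_distributive quat_mul quat_add.
Proof. by move=> [? ? ? ?] [? ? ? ?] [? ? ? ?]; congr Quat => /=; ring. Qed.
Lemma quat1_neq0 : quat1 != quat0.
Proof. by apply/eqP => -[] /eqP; rewrite oner_eq0. Qed.

HB.instance Definition _ := GRing.Zmodule_isNzRing.Build (quat R)
  quat_mulA quat_mul1q quat_mul1 quat_mulDl quat_mulDr quat1_neq0.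

Definition quat_real (r : R) : quat R := Quat r 0 0 0.
Definition quat_conj q := Quat (qre q) (- qi q) (- qj q) (- qk q).
Definition quat_norm q : R :=
  Num.sqrt (qre q ^+ 2 + qi q ^+ 2 + qj q ^+ 2 + qk q ^+ 2).

Lemma quat_mul_conj q : q * quat_conj q = quat_real (quat_norm q ^+ 2).
Proof.
rewrite sqr_sqrtr ?addr_ge0 ?sqr_ge0 //.
by case: q => a b c d; congr Quat => /=; ring.
Qed.

Lemma quat_norm_eq0 q : (quat_norm q == 0) = (q == 0).
Proof.
rewrite /quat_norm sqrtr_eq0 le_eqVlt ltNge !addr_ge0 ?sqr_ge0 // orbF.
rewrite !paddr_eq0 ?addr_ge0 ?sqr_ge0 // !sqrf_eq0.
case: q => a b c d /=; apply/idP/eqP => [|[-> -> -> ->]]; last by rewrite eqxx.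
by move=> /andP[/andP[/andP[/eqP-> /eqP->] /eqP->] /eqP->].
Qed.

Lemma quat_skew_field q : q != 0 -> exists p, p * q = 1 /\ q * p = 1.
Proof.
rewrite -quat_norm_eq0 => q0.
have N0 : quat_norm q ^+ 2 != 0 by rewrite expf_neq0.
have NE : quat_norm q ^+ 2 = qre q ^+ 2 + qi q ^+ 2 + qj q ^+ 2 + qk q ^+ 2.
  by rewrite sqr_sqrtr ?addr_ge0 ?sqr_ge0.
exists (quat_real (quat_norm q ^+ 2)^-1 * quat_conj q); move: N0; rewrite NE.
by case: q {q0 NE} => a b c d /= N0; split; congr Quat => /=; field.
Qed.

End QuatRing.

(* A right quaternionic Hilbert space, over the real Banach space obtained by
   restricting the scalars to R.  [scaleq u q] is u q.  The norm and the real
   scaling inherited from [completeNormedModType] carry no extra information: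
   they are determined by the last two axioms. *)
HB.mixin Record CompleteNormedModule_isRightQHilbert (R : realType) V
    of CompleteNormedModule R V := {
  scaleq : V -> quat R -> V;
  scaleqDl : forall u v q, scaleq (u + v) q = scaleq u q + scaleq v q;
  scaleqDr : forall u p q, scaleq u (p + q) = scaleq u p + scaleq u q;
  scaleqA : forall u p q, scaleq u (p * q) = scaleq (scaleq u p) q;
  scaleq1 : forall u, scaleq u 1 = u;
  inner : V -> V -> quat R;
  inner_conj : forall u v, inner u v = quat_conj (inner v u);
  inner_gt0 : forall v, v != 0 ->
    exists2 r : R, 0 < r & inner v v = quat_real r;
  innerDr : forall v u w, inner v (u + w) = inner v u + inner v w;
  innerZr : forall v u q, inner v (scaleq u q) = inner v u * q;
  scaleq_real : forall u (r : R), scaleq u (quat_real r) = r *: u;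
  norm_inner : forall u : V, `|u| = Num.sqrt (qre (inner u u))
}.

#[short(type="rightQHilbertType")]
HB.structure Definition RightQHilbert (R : realType) :=
  { V of CompleteNormedModule R V & CompleteNormedModule_isRightQHilbert R V }.

Section Frames.
Variables (R : realType) (H : rightQHilbertType R) (I : countType).
Implicit Types (x : I -> H) (u : H).

Definition is_frame x :=
  exists A B : R, [/\ 0 < A, A <= B & forall u,
    ((A * `|u| ^+ 2)%:E <= \esum_(i in [set: I]) (quat_norm (inner (x i) u) ^+ 2)%:E
     /\ \esum_(i in [set: I]) (quat_norm (inner (x i) u) ^+ 2)%:E
          <= (B * `|u| ^+ 2)%:E)%E].

Definition frame_term x u (i : I) : H := scaleq (x i) (inner (x i) u).

(* Convergence of the net of partial sums over the finite subsets of I, ordered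
   by inclusion. *)
Definition frame_op_defined x :=
  forall u, cvg (partial_sum (frame_term x u) @ totally).

(* The sum of the series, meaningful when [frame_op_defined x] holds. *)
Definition frame_op x u : H := sum (frame_term x u).

End Frames.

(* Main.v *)
(** Write Q u = Re <u, S u>, the sum of the |<x_i, u>|^2; the finite partial sums
of S obey a Cauchy-Schwarz inequality for the corresponding partial sums of Q.

If x is a frame with bounds A and B, this inequality bounds the squared norm of
a finite sum by B times its part of Q, so the series defining S u is Cauchy.  It
also gives |S u| <= B |u|, whence |u - t S u|^2 <= (1 - 2 t A + t^2 B^2) |u|^2;
for t = A / B^2 the map u |-> u - t (S u - w) is thus a contraction, and its
fixed point is a preimage of w under S.

Conversely, the uniform boundedness principle gives both frame bounds.  The
finite sums attached to vectors u whose part of Q is at most 1 are weakly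
bounded, which yields the upper bound.  If S is onto, the set {u | Q u <= 1} is
weakly bounded, since |Re <u, S z>|^2 <= Q u * Q z, which yields the lower
bound. *)
From mathcomp Require Import all_boot all_order all_algebra finmap ring lra.
From mathcomp Require Import all_classical all_reals all_analysis.
From mathcomp Require Import showcase.summability.
Require Import Defs.

Set Implicit Arguments.
Unset Strict Implicit.
Unset Printing Implicit Defensive.

Import Order.TTheory GRing.Theory Num.Theory.
Import numFieldNormedType.Exports.

Local Open Scope classical_set_scope.
Local Open Scope ring_scope.

(* In the library this instance is local to its section. *)
#[local] Existing Instance totally_filter.

(** The quadratic polynomial t -> [b (u + t v) (u + t v)] is nonnegative, so its discriminant is at
    most 0. The form is only semidefinite because finite pieces of the frame form, which can vanish
    on nonzero vectors, are among the applications. *)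
Lemma semi_inner_cauchy_schwarz (R : rcfType) (V : lmodType R)
    (b : V -> V -> R) :
  (forall u v, b u v = b v u) ->
  (forall u v w, b u (v + w) = b u v + b u w) ->
  (forall u a v, b u (a *: v) = a * b u v) ->
  (forall u, 0 <= b u u) ->
  forall u v, b u v ^+ 2 <= b u u * b v v.
Proof.
move=> bC bD bZ b0 u v.
pose p := Poly [:: b u u; 2 * b u v; b v v].
have szp : (size p <= 3)%N by exact: size_Poly.
have := deg_le2_poly_ge0 szp; rewrite !coef_Poly /= => h.
suff /h : forall t, 0 <= p.[t] by nra.
move=> t; rewrite horner_Poly /=.
suff -> : ((0 * t + b v v) * t + 2 * b u v) * t + b u u = b (u + t *: v) (u + t *: v).
  exact: b0.
rewrite bD bZ ![b (u + _) _]bC !bD !bZ [b v u]bC; ring.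
Qed.

(** * The underlying real inner product and uniform boundedness *)

Section RealInnerProduct.
Variables (R : realType) (H : rightQHilbertType R).
Implicit Types u v w : H.

Definition rdot u v : R := qre (inner u v).

Lemma rdotC u v : rdot u v = rdot v u.
Proof. by rewrite /rdot inner_conj. Qed.

Lemma rdotDr u v w : rdot u (v + w) = rdot u v + rdot u w.
Proof. by rewrite /rdot innerDr. Qed.

Lemma rdotZr u a v : rdot u (a *: v) = a * rdot u v.
Proof. by rewrite /rdot -scaleq_real innerZr /=; ring. Qed.

Lemma rdot0r u : rdot u 0 = 0.
Proof. by rewrite -(scale0r 0) rdotZr mul0r. Qed.

Lemma rdotBr u v w : rdot u (v - w) = rdot u v - rdot u w.
Proof. by rewrite rdotDr -scaleN1r rdotZr mulN1r. Qed.

Lemma rdotDl u v w : rdot (u + v) w = rdot u w + rdot v w.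
Proof. by rewrite rdotC rdotDr !(rdotC w). Qed.

Lemma rdotZl a u v : rdot (a *: u) v = a * rdot u v.
Proof. by rewrite rdotC rdotZr rdotC. Qed.

Lemma rdot_ge0 u : 0 <= rdot u u.
Proof.
have [->|u0] := eqVneq u 0; first by rewrite rdot0r.
by rewrite /rdot; have [r r0 ->] := inner_gt0 u u0; exact: ltW.
Qed.

Lemma rdotxx u : rdot u u = `|u| ^+ 2.
Proof. by rewrite norm_inner sqr_sqrtr// rdot_ge0. Qed.

Lemma rdot_cauchy_schwarz u v : `|rdot u v| <= `|u| * `|v|.
Proof.
rewrite -ler_sqr ?nnegrE ?mulr_ge0// real_normK ?num_real// exprMn -!rdotxx.
apply: semi_inner_cauchy_schwarz => *.
- exact: rdotC.
- exact: rdotDr.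
- exact: rdotZr.
- exact: rdot_ge0.
Qed.

Lemma rdot_continuous u : continuous (rdot u).
Proof.
move=> v; apply/cvgrPdist_lt => e e0.
have u0 : 0 < `|u| + 1 by rewrite ltr_wpDl.
near=> w; rewrite -rdotBr (le_lt_trans (rdot_cauchy_schwarz _ _))//.
rewrite (@le_lt_trans _ _ ((`|u| + 1) * `|v - w|))//.
  by rewrite ler_wpM2r// lerDl.
rewrite mulrC -ltr_pdivlMr//.
by near: w; apply: cvgr_dist_lt => //; exact: divr_gt0.
Unshelve. all: by end_near. Qed.

(* The uniform boundedness principle, for the functionals [rdot u], [u \in E]. *)
Lemma weakly_bounded_bounded (E : set H) :
  (forall w, exists M, forall u, E u -> `|rdot u w| <= M) ->
  exists2 M, 0 < M & forall u, E u -> `|u| <= M.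
Proof.
move=> Ebnd.
have : uniform_bounded [set (rdot u : H -> R^o) | u in E].
  apply: Banach_Steinhauss => [_ [u _ <-]|w]; last first.
    have [M EM] := Ebnd w; exists M => _ [u Eu <-]; exact: EM.
  split=> [r|a v w]; last by rewrite rdotDr rdotZr.
  exists (`|u| * r) => v vr; rewrite (le_trans (rdot_cauchy_schwarz _ _))//.
  by rewrite ler_wpM2l.
move=> /(_ 1)[M EM]; exists (`|M| + 1); first by rewrite ltr_wpDl.
move=> u Eu; rewrite (@le_trans _ _ `|M|) ?lerDl//.
have [->|u0] := eqVneq u 0; first by rewrite normr0.
have nu0 : `|u| != 0 by rewrite normr_eq0.
(* The unit vector in the direction of [u] recovers the norm of [u]. *)
have := EM (rdot u) (imageP _ Eu) (`|u|^-1 *: u).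
rewrite normrZ normfV normr_id mulVf// => /(_ (lexx _)).
rewrite rdotZr rdotxx expr2 mulKf// normr_id => /le_trans; apply.
exact: ler_norm.
Qed.

(* Uniform boundedness applied to the multiples [a *: f t] with
   [a ^+ 2 * N t <= 1]. *)
Lemma weak_form_bound (T : Type) (f : T -> H) (N : T -> R) :
  (forall t, 0 <= N t) ->
  (forall w, exists M, forall t, rdot (f t) w ^+ 2 <= M * N t) ->
  exists2 M, 0 < M & forall t, `|f t| ^+ 2 <= M * N t.
Proof.
move=> N0 fN.
pose E := [set v | exists a t, a ^+ 2 * N t <= 1 /\ v = a *: f t].
have [w|M M0 EM] := @weakly_bounded_bounded E.
  have [M fM] := fN w; exists (`|M| + 1) => _ [a [t [aN ->]]].
  rewrite -ler_sqr ?nnegrE ?addr_ge0// real_normK ?num_real//.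
  rewrite rdotZl exprMn (@le_trans _ _ `|M|)//.
    rewrite (@le_trans _ _ (a ^+ 2 * (`|M| * N t)))//.
      rewrite ler_wpM2l ?sqr_ge0// (le_trans (fM t))//.
      by rewrite ler_wpM2r// ler_norm.
    by rewrite mulrCA ler_piMr.
  have := normr_ge0 M; nra.
exists (M ^+ 2) => [|t]; first exact: exprn_gt0.
(* If [N t = 0], the weak bound at w = [f t] forces [f t = 0]; otherwise a = 1 / sqrt (N t) attains
   a^2 * N t = 1. *)
have [Nt|Nt0] := eqVneq (N t) 0.
  have [K /(_ t)] := fN (f t); rewrite Nt !mulr0 rdotxx => h.
  have : `|f t| ^+ 2 ^+ 2 == 0 by rewrite eq_le h sqr_ge0.
  by rewrite !expf_eq0/= => /eqP ->; rewrite expr0n.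
have Nt : 0 < N t by rewrite lt_neqAle eq_sym Nt0/=.
have := EM ((Num.sqrt (N t))^-1 *: f t).
rewrite normrZ normfV ger0_norm ?sqrtr_ge0// mulrC ler_pdivrMr ?sqrtr_gt0//.
rewrite -ler_sqr ?nnegrE ?mulr_ge0 ?sqrtr_ge0 ?(ltW M0)//.
rewrite exprMn sqr_sqrtr ?(ltW Nt)//; apply.
exists (Num.sqrt (N t))^-1, t; split => //.
by rewrite exprVn sqr_sqrtr ?(ltW Nt)// mulVf.
Qed.
End RealInnerProduct.

(** * Finite partial sums of a family *)

Section PartialSums.
Variables (R : realType) (H : rightQHilbertType R) (I : choiceType).
Implicit Types (y : I -> H) (J K : {fset I}).

Lemma partial_sumE y J : partial_sum y J = \sum_(i <- J) y i.
Proof. by rewrite /partial_sum big_seq_fsetE. Qed.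

Lemma rdot_partial_sum u y J :
  rdot u (partial_sum y J) = \sum_(i <- J) rdot u (y i).
Proof.
by rewrite partial_sumE (big_morph _ (@rdotDr _ _ u) (@rdot0r _ _ u)).
Qed.

Lemma partial_sumB y J K : (J `<=` K)%fset ->
  partial_sum y (K `\` J)%fset = partial_sum y K - partial_sum y J.
Proof.
move=> /fsetIidPr JK; rewrite !partial_sumE [in RHS](big_fsetID _ (mem J) K)/=.
rewrite (_ : [fset i in K | i \in J]%fset = J); last first.
  by rewrite -[RHS]JK; apply/fsetP => i; rewrite !inE.
rewrite addrAC subrr add0r; apply: eq_fbigl => i.
by rewrite !inE andbC.
Qed.

Lemma cvg_rdot_partial_sum y u : cvg (partial_sum y @ totally) ->
  rdot u (partial_sum y J) @[J --> totally] --> rdot u (sum y).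
Proof. by move=> ycvg; apply: (cvg_comp _ _ ycvg); exact: rdot_continuous. Qed.

End PartialSums.

(** * Finite pieces of the frame operator and their energies *)

Section FrameOperator.
Variables (R : realType) (H : rightQHilbertType R) (I : countType) (x : I -> H).
Implicit Types (u v w : H) (J K : {fset I}).

Let psum u J := partial_sum (frame_term x u) J.
Let energy J u := rdot u (psum u J).

Lemma psumD J u v : psum (u + v) J = psum u J + psum v J.
Proof.
rewrite /psum !partial_sumE -big_split; apply: eq_bigr => i _.
by rewrite /frame_term innerDr scaleqDr.
Qed.

Lemma psumZ J a u : psum (a *: u) J = a *: psum u J.
Proof.
rewrite /psum !partial_sumE scaler_sumr; apply: eq_bigr => i _.
by rewrite /frame_term -!scaleq_real innerZr scaleqA.
Qed.

Lemma rdot_frame_term u v i : rdot u (frame_term x v i) =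
  qre (quat_conj (inner (x i) u) * inner (x i) v).
Proof. by rewrite /rdot innerZr (inner_conj u). Qed.

(** The real part of conj(p) q is the Euclidean inner product of R^4, hence symmetric in p and q. *)
Lemma rdot_frame_termC u v i :
  rdot u (frame_term x v i) = rdot v (frame_term x u i).
Proof. rewrite !rdot_frame_term /=; ring. Qed.

Lemma energyE J u :
  energy J u = \sum_(i <- J) quat_norm (inner (x i) u) ^+ 2.
Proof.
rewrite /energy rdot_partial_sum; apply: eq_bigr => i _.
rewrite rdot_frame_term sqr_sqrtr ?addr_ge0 ?sqr_ge0//=; ring.
Qed.

Lemma energy_ge0 J u : 0 <= energy J u.
Proof. by rewrite energyE sumr_ge0// => i _; exact: sqr_ge0. Qed.

Lemma psum_cauchy_schwarz J u v :
  rdot u (psum v J) ^+ 2 <= energy J u * energy J v.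
Proof.
apply: (semi_inner_cauchy_schwarz (b := fun u v => rdot u (psum v J))).
- move=> {}u {}v; rewrite !rdot_partial_sum.
  by apply: eq_bigr => i _; exact: rdot_frame_termC.
- by move=> {}u {}v w; rewrite psumD rdotDr.
- by move=> {}u a {}v; rewrite psumZ rdotZr.
- by move=> {}u; exact: energy_ge0.
Qed.

(** The extended sum is a supremum over finite subsets; this turns bounds on it into real bounds
    uniform in [J]. *)
Lemma esum_le_energy u M :
  (\esum_(i in [set: I]) (quat_norm (inner (x i) u) ^+ 2)%:E <= M%:E)%E <->
  (forall J, energy J u <= M).
Proof.
split=> [h J|h].
  rewrite energyE -lee_fin -sumEFin; apply: le_trans h; apply: esum_ge.
  by exists [set` J] => //; rewrite fsbig_finite// set_fsetK.
apply: ge_ereal_sup => _ [X [finX _]] <-.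
by rewrite fsbig_finite// sumEFin lee_fin -energyE.
Qed.

Lemma energyB J K u : (J `<=` K)%fset ->
  energy (K `\` J)%fset u = energy K u - energy J u.
Proof. by move=> JK; rewrite /energy /psum partial_sumB// rdotBr. Qed.

Lemma energy_nondecreasing J K u : (J `<=` K)%fset -> energy J u <= energy K u.
Proof. by move=> JK; rewrite -subr_ge0 -energyB// energy_ge0. Qed.

(** * From an upper bound to convergence *)

Section BesselBound.
Variables (B : R) (energyB_le : forall J u, energy J u <= B * `|u| ^+ 2).

(** Cauchy-Schwarz against the partial sum itself gives s^2 <= (B s) * energy, where s is its
    squared norm; then s cancels. *)
Lemma psum_bessel J u : `|psum u J| ^+ 2 <= B * energy J u.
Proof.
have := psum_cauchy_schwarz J (psum u J) u; rewrite rdotxx.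
have := energyB_le J (psum u J).
have := energy_ge0 J u; set s := `|_| ^+ 2.
move=> e0 h1 h2.
have [s0|s0] := ltP 0 s.
  rewrite -(ler_pM2l s0) -expr2 (le_trans h2)//.
  by rewrite mulrA (mulrC s) ler_wpM2r.
(* A negative [B] forces the energy to be 0. *)
apply: le_trans s0 _; have [B0|B0] := leP 0 B; first exact: mulr_ge0.
have := energyB_le J u; have := sqr_ge0 `|u|; nra.
Qed.

Lemma bessel_frame_op_defined : frame_op_defined x.
Proof.
move=> u; apply/cauchy_cvgP/cauchy_exP => e e0.
pose E := [set energy J u | J in [set: {fset I}]].
have supE : has_sup E.
  split; first by exists (energy fset0 u), fset0.
  by exists (B * `|u| ^+ 2) => _ [J _ <-].
have B0 : 0 < `|B| + 1 by rewrite ltr_wpDl.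
(* Past a [J] whose energy is this close to the supremum, further terms have energy below e^2 / (|B|
   + 1), hence a sum of norm below e. *)
have d0 : 0 < e ^+ 2 / (`|B| + 1) by rewrite divr_gt0// exprn_gt0.
have [_ [J _ <-] supJ] := sup_adherent d0 supE.
exists (psum u J), J => // K JK; rewrite -ball_normE/= distrC.
rewrite -ltr_sqr ?nnegrE ?(ltW e0)// -partial_sumB//.
rewrite (le_lt_trans (psum_bessel _ _))// energyB//.
have : energy K u <= sup E by apply: sup_upper_bound => //; exists K.
have := energy_nondecreasing u JK.
move: supJ; rewrite ltrBlDr -ltrBlDl ltr_pdivlMr// => h1 h2 h3.
have := ler_norm B; nra.
Qed.

End BesselBound.

(** * The limit operator and its quadratic form *)

Section DefinedOperator.
Hypothesis xdef : frame_op_defined x.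

Let Q u := rdot u (frame_op x u).

Lemma cvg_rdot_psum u v :
  rdot u (psum v J) @[J --> totally] --> rdot u (frame_op x v).
Proof. exact: cvg_rdot_partial_sum. Qed.

Lemma energy_le_form J u : energy J u <= Q u.
Proof.
apply: (closed_cvg (fun r => energy J u <= r) _ _ _ (@cvg_rdot_psum u u)).
  exact: closed_ge.
by exists J => // K JK; exact: energy_nondecreasing.
Qed.

Lemma form_le_bound u M : (forall J, energy J u <= M) -> Q u <= M.
Proof.
move=> uM; apply: (closed_cvg (fun r => r <= M) _ _ _ (@cvg_rdot_psum u u)).
  exact: closed_le.
by exists fset0 => // K _; exact: uM.
Qed.

Lemma form_ge0 u : 0 <= Q u.
Proof. exact: le_trans (energy_ge0 fset0 u) (energy_le_form _ _). Qed.

(** Only the first factor is enlarged to [Q]: the constant is then uniform in [J] and [v], as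
    [weak_form_bound] requires. *)
Lemma psum_cauchy_schwarz_form J u v :
  rdot u (psum v J) ^+ 2 <= Q u * energy J v.
Proof.
apply: le_trans (psum_cauchy_schwarz _ _ _) _.
by rewrite ler_wpM2r ?energy_ge0// energy_le_form.
Qed.

Lemma frame_op_cauchy_schwarz u v : rdot u (frame_op x v) ^+ 2 <= Q u * Q v.
Proof.
have cvg2 : rdot u (psum v J) ^+ 2 @[J --> totally] --> rdot u (frame_op x v) ^+ 2.
  by rewrite expr2; apply: cvgM; exact: cvg_rdot_psum.
apply: (closed_cvg (fun r => r <= Q u * Q v) _ _ _ cvg2); first exact: closed_le.
exists fset0 => // K _ /=; apply: le_trans (psum_cauchy_schwarz_form _ _ _) _.
by rewrite ler_wpM2l ?form_ge0// energy_le_form.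
Qed.

Lemma frame_opB u v : frame_op x (u - v) = frame_op x u - frame_op x v.
Proof.
apply: cvg_lim => //; rewrite (_ : partial_sum _ = psum u \- psum v).
  by apply: cvgB; exact: xdef.
apply/funext => J; rewrite /= /psum -[RHS]/(psum u J - psum v J).
by rewrite -[- psum v J]scaleN1r -psumZ -psumD scaleN1r.
Qed.

Lemma form_bound_surj (A B : R) : 0 < A -> A <= B ->
  (forall u, A * `|u| ^+ 2 <= Q u) -> (forall u, Q u <= B * `|u| ^+ 2) ->
  set_surj [set: H] [set: H] (frame_op x).
Proof.
move=> A0 AB AQ QB w _; have B0 := lt_le_trans A0 AB.
have frame_op_le u : `|frame_op x u| ^+ 2 <= B ^+ 2 * `|u| ^+ 2.
  have [s0|s0] := ltP 0 (`|frame_op x u| ^+ 2); last first.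
    by rewrite (le_trans s0)// mulr_ge0// sqr_ge0.
  have := frame_op_cauchy_schwarz (frame_op x u) u; rewrite rdotxx => cs.
  rewrite -(ler_pM2l s0) -expr2 (le_trans cs)//.
  rewrite (_ : _ * (_ * _) = (B * `|frame_op x u| ^+ 2) * (B * `|u| ^+ 2)).
    by rewrite ler_pM ?form_ge0 ?QB.
  ring.
(* This t minimizes 1 - 2 t A + t^2 B^2, and k is the minimum. *)
pose t := A / B ^+ 2; pose k := 1 - A ^+ 2 / B ^+ 2.
have k0 : 0 <= k.
  by rewrite subr_ge0 ler_pdivrMr ?exprn_gt0// mul1r ler_sqr ?nnegrE// ltW.
have k1 : k < 1 by rewrite ltrBlDr ltrDl divr_gt0 ?exprn_gt0.
pose f u := u - t *: (frame_op x u - w).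
have fB u v : `|f u - f v| ^+ 2 <= k * `|u - v| ^+ 2.
  have -> : f u - f v = (u - v) - t *: frame_op x (u - v).
    rewrite frame_opB /f opprB [_ *: _ - v]addrC addrACA; congr (_ + _).
    by rewrite addrC -scalerBr opprB addrA subrK -scalerN opprB.
  move: (u - v) => d; rewrite -rdotxx rdotBr ![rdot (_ - _) _]rdotC !rdotBr.
  rewrite !rdotZr !rdotZl !rdotxx (rdotC _ d) -/(Q d).
  have -> : k * `|d| ^+ 2 = `|d| ^+ 2 - 2 * t * (A * `|d| ^+ 2) +
      t ^+ 2 * (B ^+ 2 * `|d| ^+ 2).
    by rewrite /k /t; field; rewrite gt_eqF.
  have t0 : 0 < t by rewrite divr_gt0 ?exprn_gt0.
  have := ler_wpM2l (sqr_ge0 t) (frame_op_le d).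
  have := ler_wpM2l (ltW t0) (AQ d).
  lra.
have q0 : 0 <= Num.sqrt k by exact: sqrtr_ge0.
have [||p _ pE] := @banach_fixed_point R H setT (totalfun f) _ closedT.
(* Since k controls squared norms, the Lipschitz constant is its square root. *)
- exists (NngNum q0); split=> /=; first by rewrite -sqrtr1 ltr_sqrt.
  by move=> [u v] _ /=; rewrite -ler_sqr ?nnegrE ?mulr_ge0// exprMn sqr_sqrtr//.
- by exists 0.
exists p => //; move/eqP: pE; rewrite /totalfun_ /f -subr_eq0 opprB addrC subrK.
by rewrite scaler_eq0 subr_eq0 gt_eqF ?divr_gt0 ?exprn_gt0//= => /eqP.
Qed.

(** For w = S z, the constant in the weak bound is [Q z]. *)
Lemma surj_lower_bound : set_surj [set: H] [set: H] (frame_op x) ->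
  exists2 M, 0 < M & forall u, `|u| ^+ 2 <= M * Q u.
Proof.
move=> xsurj; apply: (weak_form_bound form_ge0) => w.
have [z _ <-] := xsurj w Logic.I; exists (Q z) => u.
by rewrite mulrC frame_op_cauchy_schwarz.
Qed.

Lemma energy_upper_bound :
  exists2 M, 0 < M & forall J u, energy J u <= M * `|u| ^+ 2.
Proof.
(* Indexing by pairs (u, J) makes the bound uniform over finite subsets as well. *)
have [//|w|M M0 psumM] := @weak_form_bound R H (H * {fset I})%type
  (fun t => psum t.1 t.2) (fun t => energy t.2 t.1).
- by move=> t; exact: energy_ge0.
- exists (Q w) => -[u J]; rewrite rdotC; exact: psum_cauchy_schwarz_form.
exists M => // J u; have := psumM (u, J); have := rdot_cauchy_schwarz u (psum u J).
rewrite ger0_norm ?energy_ge0//= => h1 h2.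
have [e0|e0] := ltP 0 (energy J u); last first.
  by rewrite (le_trans e0)// mulr_ge0 ?sqr_ge0// ltW.
(* With e the energy, e^2 <= |u|^2 |psum|^2 <= |u|^2 M e, and e > 0 cancels. *)
rewrite -(ler_pM2l e0) -expr2 (@le_trans _ _ ((`|u| * `|psum u J|) ^+ 2))//.
  by rewrite ler_sqr ?nnegrE ?mulr_ge0// ltW.
by rewrite exprMn [leRHS]mulrA (mulrC _ M) [leRHS]mulrC ler_wpM2l ?sqr_ge0.
Qed.

End DefinedOperator.

End FrameOperator.

Theorem theorem14 (R : realType) (H : rightQHilbertType R) (I : countType)
    (x : I -> H) :
  is_frame x <->
  frame_op_defined x /\ set_surj [set: H]%classic [set: H]%classic (frame_op x).
Proof.
split=> [[A [B [A0 AB frameAB]]]|[xdef xsurj]].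
  have xB J u : rdot u (partial_sum (frame_term x u) J) <= B * `|u| ^+ 2.
    by have [_ /esum_le_energy] := frameAB u; apply.
  have xdef := bessel_frame_op_defined xB.
  split=> //; apply: (form_bound_surj xdef A0 AB) => u; last first.
    by apply: form_le_bound => // J; exact: xB.
  rewrite -lee_fin (le_trans (frameAB u).1)//; apply/esum_le_energy => J.
  exact: energy_le_form.
have [A A0 lowA] := surj_lower_bound xdef xsurj.
have [B B0 upB] := energy_upper_bound xdef.
(* The maximum ensures that the lower bound does not exceed the upper one. *)
exists A^-1, (Num.max A^-1 B); split; rewrite ?invr_gt0 ?le_max ?lexx//.
move=> u; split; last first.
  apply/esum_le_energy => J; rewrite (le_trans (upB J u))//.
  by rewrite ler_wpM2r ?sqr_ge0// le_max lexx orbT.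
apply: (@le_trans _ _ (rdot u (frame_op x u))%:E).
  by rewrite lee_fin mulrC ler_pdivrMr// mulrC.
set s := (\esum_(i in _) _)%E.
have : (s <= (rdot u (frame_op x u))%:E)%E.
  by apply/esum_le_energy => J; exact: energy_le_form.
have : (0 <= s)%E by apply: esum_ge0 => i _; rewrite lee_fin sqr_ge0.
(* Being nonnegative and bounded above, [s] is a real number, so it bounds all finite energies and
   hence their limit. *)
have {lowA upB} := esum_le_energy x u (fine s); rewrite -/s.
case: s => [r| |]//= [/(_ (lexx _)) rE _] _ _; rewrite lee_fin.
exact: form_le_bound.
Qed.
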